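(* In the setting and under the regularity assumption of the context, let $f(x,\mathbb Q)=\mathbb E_{z\sim\mathbb Q}[\ell(x,z)]$. Let $T\ge1$, $\delta\ge0$, and let sequences $x_1,\dots,x_T\in\mathcal X$ and $\mathbb Q_1,\dots,\mathbb Q_T\in\mathcal P$ be generated by the Distributional Best-Response algorithm (starting from $x_1\in\mathcal X$; for $t=1,\dots,T$, a worst-case expectation oracle returns $\mathbb Q_t$ given $x_t$, and then $x_{t+1}=\mathcal A(x_t,f(\cdot,\mathbb Q_t))\in\mathcal X$ for an online algorithm $\mathcal A$), with output $\bar x_T=\frac1T\sum_{t=1}^Tx_t$ and $\bar{\mathbb Q}_T=\frac1T\sum_{t=1}^T\mathbb Q_t$. Assume: (a) (worst-case expectation oracle) for every $t$, $\mathbb Q_t\in\mathcal P$ and $\mathbb E_{z\sim\mathbb Q_t}[\ell(x_t,z)]\ge\max_{\mathbb Q\in\mathcal P}\mathbb E_{z\sim\mathbb Q}[\ell(x_t,z)]-\delta$; (b) (no-regret guarantee) there is a bound $\mathcal R_T=o(T)$ such that $\sum_{t=1}^Tf(x_t,\mathbb Q_t)-\min_{x\in\mathcal X}\sum_{t=1}^Tf(x,\mathbb Q_t)\le\mathcal R_T$. Then $(\bar x_T,\bar{\mathbb Q}_T)\in\mathcal X\times\mathcal P$ and $$\mathrm{Gap}(\bar x_T,\bar{\mathbb Q}_T):=\max_{\mathbb Q\in\mathcal P}f(\bar x_T,\mathbb Q)-\min_{x\in\mathcal X}f(x,\bar{\mathbb Q}_T)\le\frac{\mathcal R_T}{T}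+\delta.$$
   Context: Notation: $[n]=\{1,\dots,n\}$; $\mathcal P(\mathcal Z)$ is the set of Borel probability measures on $\mathcal Z$. Setting. $\mathcal X\subseteq\mathbb R^n$, $\mathcal Z\subseteq\mathbb R^m$. A transportation cost $c:\mathcal Z\times\mathcal Z\to\mathbb R_+$ is lower semicontinuous, satisfies $c(z,z)=0$ for all $z$, and $c(\cdot,\hat z)$ is convex for every fixed $\hat z\in\mathcal Z$. The optimal transport discrepancy is $\mathrm{OT}_c(\mathbb P,\mathbb Q)=\min_{\gamma}\mathbb E_{(z,\hat z)\sim\gamma}[c(z,\hat z)]$ over couplings $\gamma$ of $\mathbb P$ and $\mathbb Q$. Given $\hat z_1,\dots,\hat z_N\in\mathcal Z$, let $\hat{\mathbb P}=\frac1N\sum_{i=1}^N\delta_{\hat z_i}$; given $\rho>0$, let $\mathcal P=\{\mathbb P\in\mathcal P(\mathcal Z):\mathrm{OT}_c(\mathbb P,\hat{\mathbb P})\le\rho\}$. Regularity assumption. (i) $\mathcal X$ is nonempty and convex; there exist $\mathbb Q_0\in\mathcal P$ and $x_0\in\mathcal X$ such that $x\mapsto\mathbb E_{z\sim\mathbb Q_0}[\ell(x,z)]$ is inf-compact on $\mathcal X$ (all sublevel sets are compact) and $\mathbb E_{z\sim\mathbb Q_0}[\ell(x_0,z)]>-\infty$; $\mathcal Z$ is nonempty, closed and convex. (ii) $\ell(x,z)=\max_{k\in[K]}\ell_k(x,z)$ with $K\ge2$, where each $\ell_k:\mathbb R^n\times\mathbb R^m\to\mathbb R$ is real-valued, convex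 in its first and concave in its second argument. (iii) There exist a norm $\|\cdot\|$ on $\mathbb R^m$ and $p\ge1$ with $c(z,\hat z)\ge\|z-\hat z\|^p$ for all $z,\hat z\in\mathcal Z$; moreover, if $p=1$, then for every $x\in\mathcal X$ there exist $g>0$, $\hat z_0\in\mathcal Z$ and $r\in[0,1)$ such that $\ell(x,z)\le g[1+\|z-\hat z_0\|^r]$ for all $z\in\mathcal Z$. *)

(* Defs.v *)
From HB Require Import structures.
From mathcomp Require Import all_boot all_order all_algebra.
From mathcomp Require Import all_classical all_reals all_analysis.

Set Implicit Arguments.
Unset Strict Implicit.
Unset Printing Implicit Defensive.

Import Order.TTheory GRing.Theory Num.Theory.
Import numFieldNormedType.Exports.

Local Open Scope classical_set_scope.
Local Open Scope ring_scope.

(* R^m with its Borel sigma-algebra. Probability measures on a closed set Z are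
   encoded as Borel measures on R^m of mass 1 that are concentrated on Z. *)
Definition borelRV (R : realType) (m : nat) :=
  g_sigma_algebraType (@open 'rV[R]_m).

Definition borel_measure (R : realType) (m : nat) :=
  {measure set (borelRV R m) -> \bar R}.

Section setting.
Context {R : realType} {n m : nat}.

Definition is_norm (nrm : 'rV[R]_m -> R) : Prop :=
  [/\ forall u v, nrm (u + v) <= nrm u + nrm v,
      forall (a : R) u, nrm (a *: u) = `|a| * nrm u &
      forall u, nrm u = 0 -> u = 0].

(* The values of c outside Z x Z are irrelevant: lower semicontinuity is taken
   in the topology of the subspace Z x Z, in which the points outside Z x Z are
   isolated. *)
Record transport_cost (Z : set 'rV[R]_m) (c : 'rV[R]_m -> 'rV[R]_m -> R) :
    Prop := {
  cost_ge0 : forall z zh, Z z -> Z zh -> 0 <= c z zh ;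
  cost_lsc : lower_semicontinuous
    (fun w : subspace (Z `*` Z) => (c w.1 w.2)%:E) ;
  cost_diag : forall z, Z z -> c z z = 0 ;
  cost_convex : forall zh, Z zh -> convex_function Z (fun z => c z zh) }.

Definition prob_on (Z : set 'rV[R]_m) : set (borel_measure R m) :=
  [set P | P [set: borelRV R m] = 1%E /\ P Z = 1%E].

Definition coupling (P Q : borel_measure R m) :
    set {measure set (borelRV R m * borelRV R m) -> \bar R} :=
  [set gam | (forall A : set (borelRV R m),
                measurable A -> gam (A `*` setT) = P A) /\
             (forall A : set (borelRV R m),
                measurable A -> gam (setT `*` A) = Q A)].

Definition OT (Z : set 'rV[R]_m) (c : 'rV[R]_m -> 'rV[R]_m -> R)
    (P Q : borel_measure R m) : \bar R :=
  ereal_inf [set \int[gam]_(w in Z `*` Z) (c w.1 w.2)%:E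
            | gam in coupling P Q]%E.

Definition avg_measure (N : nat) (Q : nat -> borel_measure R m) :
    borel_measure R m :=
  mscale (N%:R^-1)%:nng (msum Q N).

Definition empirical (N : nat) (zhat : nat -> 'rV[R]_m) : borel_measure R m :=
  avg_measure N (fun i => dirac (zhat i : borelRV R m)).

Definition ambiguity_set (Z : set 'rV[R]_m) (c : 'rV[R]_m -> 'rV[R]_m -> R)
    (N : nat) (zhat : nat -> 'rV[R]_m) (rho : R) : set (borel_measure R m) :=
  [set P | prob_on Z P /\ (OT Z c P (empirical N zhat) <= rho%:E)%E].

(* Extended-real valued; +oo + -oo is -oo by the library convention. *)
Definition expected_loss (ell : 'rV[R]_n -> 'rV[R]_m -> R) (x : 'rV[R]_n)
    (Q : borel_measure R m) : \bar R :=
  (\int[Q]_z (ell x z)%:E)%E.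

Definition inf_compact_on (X : set 'rV[R]_n) (F : 'rV[R]_n -> \bar R) : Prop :=
  forall a : R, compact [set x | X x /\ (F x <= a%:E)%E].

Record regularity (X : set 'rV[R]_n) (Z : set 'rV[R]_m)
    (c : 'rV[R]_m -> 'rV[R]_m -> R) (PP : set (borel_measure R m))
    (K : nat) (ell_ : 'I_K -> 'rV[R]_n -> 'rV[R]_m -> R)
    (ell : 'rV[R]_n -> 'rV[R]_m -> R) : Prop := {
  reg_X0 : X !=set0 ;
  reg_Xconvex : convex_set X ;
  reg_infcompact : exists Q0 x0,
    [/\ PP Q0, X x0, inf_compact_on X (expected_loss ell ^~ Q0) &
        (-oo < expected_loss ell x0 Q0)%E] ;
  reg_Z0 : Z !=set0 ;
  reg_Zclosed : closed Z ;
  reg_Zconvex : convex_set Z ;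
  reg_K : (2 <= K)%N ;
  reg_max : forall x z,
    (ell x z)%:E = \big[Order.max/-oo%E]_(k < K) (ell_ k x z)%:E ;
  reg_convex : forall k z, convex_function setT (fun x => ell_ k x z) ;
  reg_concave : forall k x, convex_function setT (fun z => - ell_ k x z) ;
  reg_growth : exists (nrm : 'rV[R]_m -> R) (p : R),
    [/\ is_norm nrm, 1 <= p,
        forall z zh, Z z -> Z zh -> nrm (z - zh) `^ p <= c z zh &
        p = 1 -> forall x, X x -> exists (g : R) (z0 : 'rV[R]_m) (r : R),
          [/\ 0 < g, Z z0, 0 <= r < 1 &
              forall z, Z z -> ell x z <= g * (1 + nrm (z - z0) `^ r)]] }.

Definition worst_case (PP : set (borel_measure R m))
    (ell : 'rV[R]_n -> 'rV[R]_m -> R) (x : 'rV[R]_n) : \bar R :=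
  ereal_sup [set expected_loss ell x Q | Q in PP].

Definition oracle_answer (PP : set (borel_measure R m))
    (ell : 'rV[R]_n -> 'rV[R]_m -> R) (delta : R) (x : 'rV[R]_n)
    (Q : borel_measure R m) : Prop :=
  PP Q /\ (worst_case PP ell x - delta%:E <= expected_loss ell x Q)%E.

(* Iterates are numbered from 0: x t and Q t are the (t+1)-st iterates. Only
   the terms with t < T, and x T, are constrained. *)
Record DBR_run (X : set 'rV[R]_n) (PP : set (borel_measure R m))
    (ell : 'rV[R]_n -> 'rV[R]_m -> R) (delta : R)
    (A : 'rV[R]_n -> ('rV[R]_n -> \bar R) -> 'rV[R]_n) (T : nat)
    (x : nat -> 'rV[R]_n) (Q : nat -> borel_measure R m) : Prop := {
  run_init : X (x 0%N) ;
  run_oracle : forall t, (t < T)%N -> oracle_answer PP ell delta (x t) (Q t) ;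
  run_update : forall t, (t < T)%N ->
    x t.+1 = A (x t) (expected_loss ell ^~ (Q t)) /\ X (x t.+1) }.

Definition regret (X : set 'rV[R]_n) (ell : 'rV[R]_n -> 'rV[R]_m -> R)
    (T : nat) (x : nat -> 'rV[R]_n) (Q : nat -> borel_measure R m) : \bar R :=
  (\sum_(t < T) expected_loss ell (x t) (Q t)
   - ereal_inf [set \sum_(t < T) expected_loss ell y (Q t) | y in X])%E.

Definition gap (X : set 'rV[R]_n) (PP : set (borel_measure R m))
    (ell : 'rV[R]_n -> 'rV[R]_m -> R) (x : 'rV[R]_n) (Q : borel_measure R m) :
    \bar R :=
  (worst_case PP ell x - ereal_inf [set expected_loss ell y Q | y in X])%E.

Definition avg_point (T : nat) (x : nat -> 'rV[R]_n) : 'rV[R]_n :=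
  T%:R^-1 *: \sum_(t < T) x t.

End setting.

(* Main.v *)
Require Import Defs.
From HB Require Import structures.
From mathcomp Require Import all_boot all_order all_algebra.
From mathcomp Require Import all_classical all_reals all_analysis.
From mathcomp Require Import measurable_realfun lra.
Import Order.TTheory GRing.Theory Num.Theory.
Import numFieldNormedType.Exports.
Local Open Scope classical_set_scope.
Local Open Scope ring_scope.

Set Implicit Arguments.
Unset Strict Implicit.
Unset Printing Implicit Defensive.

(* Write f(x, Q) for the expected loss. Convexity of f(., Q) and linearity of
   f(x, .) give
     max f(xbar, .) <= (1/T) sum_t max f(x_t, .)
                    <= (1/T) sum_t f(x_t, Q_t) + delta,
     min f(., Qbar) = (1/T) min_x sum_t f(x, Q_t),
   and the regret bound compares the two right-hand sides. Averaging transport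
   plans shows that the ambiguity set is convex.

   In extended reals the subtractions need care: +oo - +oo and -oo - -oo are
   both -oo, so the regret bound is meaningful only once the sums are finite.
   A concave function on R^m grows at most linearly, and all norms are
   equivalent, so each loss is at most C + D c(z, zhat_i); hence its positive
   part is integrable under every measure of the ambiguity set. Finiteness from
   below comes from the oracle, since the empirical measure is a competitor. *)

(** * Convexity along uniform averages, and linear bounds around a point *)

Section convexity.
Context {R : realType}.

Lemma convex_setP (V : lmodType R) (X : set V) : convex_set X ->
  forall (s : R) u v, 0 <= s <= 1 -> X u -> X v -> X (s *: u + (1 - s) *: v).
Proof.
move=> cX s u v /andP[s0 s1] Xu Xv.
by have := cX u v (Itv01 s0 s1); rewrite !inE => /(_ Xu Xv).
Qed.

Lemma convex_functionP (V : lmodType R) (f : V -> R) :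
  convex_function [set: V] f ->
  forall (s : R) u v, 0 <= s <= 1 ->
    f (s *: u + (1 - s) *: v) <= s * f u + (1 - s) * f v.
Proof.
move=> cf s u v /andP[s0 s1].
by have := cf (Itv01 s0 s1) u v; rewrite !inE => /(_ I I).
Qed.

(** Splitting off the last point makes an average a two-point convex combination, so two-point
    convexity extends to averages by induction. The successors keep both denominators nonzero. *)
Lemma avg_recr (V : lmodType R) T (u : 'I_T.+2 -> V) :
  T.+2%:R^-1 *: \sum_t u t =
  (T.+1%:R / T.+2%:R) *:
      (T.+1%:R^-1 *: \sum_(t < T.+1) u (widen_ord (leqnSn _) t)) +
    (1 - T.+1%:R / T.+2%:R) *: u ord_max :> V.
Proof.
have -> : 1 - T.+1%:R / T.+2%:R = T.+2%:R^-1 :> R.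
  have T0 : T.+2%:R != 0 :> R by rewrite pnatr_eq0.
  by apply: (mulIf T0); rewrite mulrBl mulfVK// mulVf// mul1r -natrB// subSnn.
by rewrite big_ord_recr /= scalerDr scalerA mulrAC divff ?pnatr_eq0// mul1r.
Qed.

Let ratio01 T : 0 <= (T.+1%:R / T.+2%:R : R) <= 1.
Proof. by rewrite divr_ge0//= ler_pdivrMr// mul1r ler_nat. Qed.

Lemma convex_set_avg (V : lmodType R) (X : set V) T (u : 'I_T -> V) :
  convex_set X -> (0 < T)%N -> (forall t, X (u t)) ->
  X (T%:R^-1 *: \sum_t u t).
Proof.
move=> cX; case: T u => // T u _; elim: T u => [|T IH] u Xu.
  by rewrite big_ord1 invr1 scale1r.
by rewrite avg_recr; apply: convex_setP => //; exact: IH.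
Qed.

Lemma convex_function_avg (V : lmodType R) (f : V -> R) T (u : 'I_T -> V) :
  convex_function [set: V] f -> (0 < T)%N ->
  f (T%:R^-1 *: \sum_t u t) <= T%:R^-1 * \sum_t f (u t).
Proof.
move=> cf; case: T u => // T u _; elim: T u => [|T IH] u.
  by rewrite !big_ord1 !invr1 scale1r mul1r.
(* The average of the values splits by the same recursion, with the reals seen as a module over
   themselves. *)
rewrite avg_recr [leRHS](@avg_recr R^o _ (f \o u)).
apply: (le_trans (convex_functionP cf _ _ (ratio01 T))) => /=.
by rewrite lerD2r ler_wpM2l//; case/andP: (ratio01 T).
Qed.

Lemma ler_coord_norm m (h : 'rV[R]_m) j : `|h 0 j| <= `|h|.
Proof.
rewrite [leRHS](_ : _ = mx_norm h)// mx_normrE.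
by apply/bigmax_geP; right; exists (0, j).
Qed.

Section lipschitz_at_a_point.
Context {m : nat} (f : 'rV[R]_m -> R) (z0 : 'rV[R]_m).
Hypothesis cf : convex_function [set: 'rV[R]_m] f.

Let radial v (s : R) : 0 <= s <= 1 ->
  f (z0 + s *: v) <= f z0 + s * `|f (z0 + v) - f z0|.
Proof.
move=> s01; have -> : z0 + s *: v = s *: (z0 + v) + (1 - s) *: z0.
  by rewrite scalerDr scalerBl scale1r [RHS]addrC addrA subrK.
apply: (le_trans (convex_functionP cf _ _ s01)).
have : s * (f (z0 + v) - f z0) <= s * `|f (z0 + v) - f z0|.
  by rewrite ler_wpM2l ?ler_norm//; case/andP: s01.
by lra.
Qed.

(* A displacement is the average of [m] displacements along the axes. *)
Lemma convex_upper_lipschitz : exists2 B : R, 0 <= B &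
  forall h, `|h| <= 1 -> f (z0 + h) <= f z0 + B * `|h|.
Proof.
(* The factor [m%:R] makes [h] the mean of the vectors [h 0 j *: e j]; each [b j] covers both signs
   of the coordinate. *)
pose e j : 'rV[R]_m := m%:R *: 'e_j.
pose b j := `|f (z0 + e j) - f z0| + `|f (z0 - e j) - f z0|.
have b0 j : 0 <= b j by rewrite addr_ge0.
exists (\sum_j b j); first exact: sumr_ge0.
move=> h h1; have [m0|m_gt0] := posnP m.
  have -> : h = 0 by apply/rowP => -[i im]; have := im; rewrite {1}m0.
  by rewrite addr0 lerDl mulr_ge0// sumr_ge0.
have -> : z0 + h = m%:R^-1 *: \sum_j (z0 + h 0 j *: e j).
  rewrite big_split /= sumr_const card_ord -[z0 *+ _]scaler_nat.
  have -> : \sum_j h 0 j *: e j = m%:R *: h.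
    rewrite [in RHS](row_sum_delta h) scaler_sumr.
    by apply: eq_bigr => j _; rewrite !scalerA mulrC.
  by rewrite -scalerDr scalerA mulVf ?pnatr_eq0 -?lt0n// scale1r.
apply: (le_trans (convex_function_avg _ cf m_gt0)).
have step j : f (z0 + h 0 j *: e j) <= f z0 + `|h| * b j.
  have hj := ler_coord_norm h j.
  have [h0|h0] := leP 0 (h 0 j).
    have s01 : 0 <= h 0 j <= 1.
      by rewrite h0/=; move: hj; rewrite ger0_norm// => /le_trans; apply.
    apply: (le_trans (radial _ s01)); rewrite lerD2l ler_pM// /b ?lerDl//.
    by rewrite -(ger0_norm h0).
  have s01 : 0 <= - h 0 j <= 1.
    by rewrite oppr_ge0 ltW//=; move: hj; rewrite ltr0_norm// => /le_trans; apply.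
  have := radial (- e j) s01; rewrite scalerN scaleNr opprK => /le_trans; apply.
  rewrite lerD2l ler_pM// /b ?lerDr ?oppr_ge0 ?(ltW h0)//.
  by rewrite -(ltr0_norm h0).
apply: (@le_trans _ _ (m%:R^-1 * \sum_j (f z0 + `|h| * b j))).
  by rewrite ler_wpM2l// ler_sum.
rewrite big_split /= sumr_const card_ord -[f z0 *+ _]mulr_natl -mulr_sumr mulrDr.
rewrite mulrA mulVf ?pnatr_eq0 -?lt0n// mul1r lerD2l [X in _ <= X]mulrC.
by rewrite ler_piMl ?mulr_ge0 ?sumr_ge0// invf_le1 ?ltr0n// ler1n.
Qed.

(** Within the unit ball, [z0] is the midpoint of [z0 + h] and [z0 - h], so the upper bound at
    [z0 - h] yields a lower bound at [z0 + h]. Convexity along rays carries it from the unit sphere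
    to every larger [h]. For a negated concave function this is linear growth. *)
Lemma convex_lower_lipschitz : exists2 B : R, 0 <= B &
  forall h, f z0 - B * `|h| <= f (z0 + h).
Proof.
have [B B0 fB] := convex_upper_lipschitz; exists B => //.
have half : 0 <= (2^-1 : R) <= 1 by lra.
have near h : `|h| <= 1 -> f z0 - B * `|h| <= f (z0 + h).
  move=> h1; have := convex_functionP cf (z0 + h) (z0 - h) half.
  have -> : 2^-1 *: (z0 + h) + (1 - 2^-1) *: (z0 - h) = z0.
    have -> : 1 - 2^-1 = 2^-1 :> R by lra.
    rewrite -scalerDr addrACA subrr addr0 -mulr2n -[z0 *+ 2]scaler_nat scalerA.
    by rewrite mulVf ?scale1r.
  have /fB : `|- h| <= 1 by rewrite normrN.
  rewrite normrN => ub.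
  by lra.
move=> h; have [/near//|h1] := leP `|h| 1.
have h0 : 0 < `|h| by apply: lt_trans h1.
have s01 : 0 <= `|h|^-1 <= 1 by rewrite invr_ge0 (ltW h0)/= invf_le1// ltW.
have := near (`|h|^-1 *: h); rewrite normrZ gtr0_norm ?invr_gt0// mulVf ?gt_eqF//.
move=> /(_ (lexx _)) lb; have := convex_functionP cf (z0 + h) z0 s01.
have -> : `|h|^-1 *: (z0 + h) + (1 - `|h|^-1) *: z0 = z0 + `|h|^-1 *: h.
  by rewrite scalerDr scalerBl scale1r addrC addrA subrK.
have h0' : 0 < `|h|^-1 by rewrite invr_gt0.
move=> ub; rewrite -(ler_pM2l h0') mulrBr mulrCA mulVf ?gt_eqF//.
by lra.
Qed.

End lipschitz_at_a_point.
End convexity.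

(** * Open sublevel sets of convex functions, and comparison of norms *)

Section finite_dimension.
Context {R : realType} {m : nat}.

Lemma open_convex_lt (f : 'rV[R]_m -> R) (a : R) :
  convex_function [set: 'rV[R]_m] f -> open [set z | f z < a].
Proof.
move=> cf; rewrite openE => z /= fza.
have [B B0 fB] := convex_upper_lipschitz z cf.
have az : 0 < (a - f z) / (B + 1) by rewrite divr_gt0 ?subr_gt0// ltr_wpDl.
(* The bound holds only for displacements of norm at most 1, hence the minimum; [B + 1] keeps the
   denominator positive. *)
apply/(@nbhs_normP _ _ z); exists (Num.min 1 ((a - f z) / (B + 1))) => /=.
  by rewrite lt_min ltr01.
move=> y /=; rewrite lt_min => /andP[zy1 zyB].
have -> : y = z + (y - z) by rewrite addrC subrK.
have yz : `|y - z| = `|z - y| by rewrite distrC.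
apply: (le_lt_trans (fB _ _)); first by rewrite yz ltW.
rewrite -ltrBrDl yz; move: zyB; rewrite ltr_pdivlMr; last by rewrite ltr_wpDl.
apply: le_lt_trans; rewrite mulrC mulrDr mulr1 lerDl; exact: normr_ge0.
Qed.

Context (nrm : 'rV[R]_m -> R).
Hypothesis nrmP : is_norm nrm.

Lemma is_norm_ge0 u : 0 <= nrm u.
Proof.
case: nrmP => nD nZ _; have := nD u (- u).
rewrite subrr -(scaleN1r u) nZ -[X in nrm X](scale0r 0) nZ normr0 mul0r normrN1.
by lra.
Qed.

Lemma is_norm_convex : convex_function [set: 'rV[R]_m] nrm.
Proof.
case: nrmP => nD nZ _ t u v _ _.
apply: (le_trans (nD _ _)); rewrite !nZ convRE.
by rewrite ger0_norm// ger0_norm// subr_ge0.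
Qed.

(** A norm is convex, so the bound around 0 gives [nrm h <= B * |h|] on the unit ball; the triangle
    inequality transports it to every point. *)
Lemma is_norm_continuous : continuous nrm.
Proof.
case: nrmP => nD nZ _ u.
have nrm0 : nrm 0 = 0 by rewrite -(scale0r 0) nZ normr0 mul0r.
have [B B0 nB] := convex_upper_lipschitz 0 is_norm_convex.
apply/(@cvgrPdist_lt _ _ _ (nbhs u)) => e e0.
have eB : 0 < e / (B + 1) by rewrite divr_gt0// ltr_wpDl.
apply/(@nbhs_normP _ _ u); exists (Num.min 1 (e / (B + 1))) => /=.
  by rewrite lt_min ltr01.
move=> v /=; rewrite lt_min => /andP[uv1 uvB].
have uvn : nrm (u - v) <= B * `|u - v|.
  by have := nB (u - v) (ltW uv1); rewrite add0r nrm0 add0r.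
have Be : B * `|u - v| < e.
  move: uvB; rewrite ltr_pdivlMr; last by rewrite ltr_wpDl.
  by apply: le_lt_trans; rewrite mulrC mulrDr mulr1 lerDl.
have : nrm u <= nrm (u - v) + nrm v by have := nD (u - v) v; rewrite subrK.
have : nrm v <= nrm (u - v) + nrm u.
  have := nD (v - u) u; rewrite subrK -(opprB u v) -scaleN1r nZ normrN1 mul1r.
  by [].
by move=> *; rewrite ltr_norml; apply/andP; split; lra.
Qed.

(** On the compact unit sphere the continuous [nrm] has a positive minimum; by homogeneity its
    inverse is the constant. *)
Lemma is_norm_dominates : exists2 k : R, 0 <= k & forall u, `|u| <= k * nrm u.
Proof.
have [nD nZ nrm_eq0] := nrmP.
pose S : set 'rV[R]_m := [set u | `|u| = 1].
have unitS u : u != 0 -> S (`|u|^-1 *: u).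
  by move=> u0; rewrite /S /= normrZ normfV normr_id mulVf ?normr_eq0.
(* An empty sphere, as in dimension 0, leaves only [u = 0]. *)
have [S0|/set0P/negP] := pselect (S !=set0); last first.
  rewrite negbK => /eqP S0; exists 0 => // u.
  have [->|/unitS] := eqVneq u 0; first by rewrite normr0 mul0r.
  by rewrite S0.
have cS : compact S.
  apply: bounded_closed_compact.
    exists 1; split => // x x1 u; rewrite /S /= => ->; exact: ltW.
  have -> : S = (@Num.norm R _) @^-1` [set 1] by [].
  by apply: closed_comp => // u _; exact: norm_continuous.
have [c /[!inE] cS1 cmin] :=
  compact_EVT_min S0 cS (continuous_subspaceT is_norm_continuous).
have nc : 0 < nrm c.
  rewrite lt_neqAle is_norm_ge0 andbT eq_sym; apply/eqP => /nrm_eq0 c0.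
  by move: cS1; rewrite /S /= c0 normr0 => /eqP; rewrite eq_sym oner_eq0.
exists (nrm c)^-1; first by rewrite invr_ge0 ltW.
move=> u; have [->|u0] := eqVneq u 0.
  by rewrite normr0 mulr_ge0 ?is_norm_ge0// invr_ge0 ltW.
have := cmin (`|u|^-1 *: u); rewrite inE nZ normfV normr_id => /(_ (unitS _ u0)).
by rewrite ler_pdivlMl ?normr_gt0// ler_pdivlMl// mulrC.
Qed.

End finite_dimension.

(** * Integration against an average of measures *)

Section averaged_measures.
Local Open Scope ereal_scope.
Context {d : measure_display} {U : measurableType d} {R : realType}.
Import HBNNSimple.

(* The integral of a nonnegative function is a supremum over the simple
   functions below it, so no measurability is needed here. *)
Lemma ge0_le_integral_subset (mu : {measure set U -> \bar R}) (D E : set U)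
    (f g : U -> \bar R) : D `<=` E ->
  (forall x, D x -> 0 <= f x) -> (forall x, E x -> 0 <= g x) ->
  (forall x, D x -> f x <= g x) ->
  \int[mu]_(x in D) f x <= \int[mu]_(x in E) g x.
Proof.
move=> DE f0 g0 fg; rewrite !ge0_integralE//.
apply: ereal_sup_le => _ [h /= hf <-].
exists h => // x /=; apply: (le_trans (hf x)).
rewrite !patchE; case: ifPn => [/[!inE] Dx|_].
  by rewrite mem_set; [exact: fg|exact: DE].
by case: ifPn => // /[!inE] /g0.
Qed.

(** A simple function below [f] integrates linearly in the measure and is a competitor for each
    [mu i]. The supremum gives this inequality directly, in a form that applies to the transport
    cost. *)
Lemma ge0_integral_avg_le (k : {nonneg R}) (mu : {measure set U -> \bar R}^nat)
    N (D : set U) (f : U -> \bar R) : (forall x, D x -> 0 <= f x) ->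
  \int[mscale k (msum mu N)]_(x in D) f x <=
  k%:num%:E * \sum_(i < N) \int[mu i]_(x in D) f x.
Proof.
move=> f0; rewrite [leLHS]ge0_integralE//; apply: ge_ereal_sup => _ [h /= hf <-].
have h0 x : 0 <= (h x)%:E by rewrite lee_fin.
rewrite -integralT_nnsfun ge0_integral_mscale//; last exact/measurable_EFinP.
rewrite ge0_integral_measure_sum//; last exact/measurable_EFinP.
rewrite lee_wpmul2l ?lee_fin//; apply: lee_sum => i _.
rewrite ge0_integralE// ge0_integralE//.
apply: ereal_sup_le => _ [g /= gh <-].
exists g => // x.
by apply: le_trans (hf x); have := gh x; rewrite patch_setT.
Qed.

Lemma ge0_integral_dirac_le (a : U) (D : set U) (f : U -> \bar R) :
  D a -> (forall x, D x -> 0 <= f x) -> \int[\d_a]_(x in D) f x <= f a.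
Proof.
move=> Da f0; rewrite ge0_integralE//; apply: ge_ereal_sup => _ [h /= hf <-].
rewrite -integralT_nnsfun integral_dirac//; last exact/measurable_EFinP.
by rewrite diracT mul1e; apply: (le_trans (hf a)); rewrite patchE mem_set.
Qed.

(** With finite positive parts, the difference of positive and negative parts distributes over the
    sum, even if some negative parts have infinite integral. *)
Lemma integral_avg (k : {nonneg R}) (mu : {measure set U -> \bar R}^nat)
    N (f : U -> \bar R) : measurable_fun setT f ->
  (forall i, (i < N)%N -> \int[mu i]_x f^\+ x < +oo) ->
  \int[mscale k (msum mu N)]_x f x = k%:num%:E * \sum_(i < N) \int[mu i]_x f x.
Proof.
move=> mf foo; rewrite integralE.
have mp := measurable_funepos mf; have mn := measurable_funeneg mf.
rewrite !ge0_integral_mscale// !ge0_integral_measure_sum//.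
have pfin (i : 'I_N) : \int[mu i]_x f^\+ x \is a fin_num.
  by rewrite ge0_fin_numE ?foo// integral_ge0.
have sfin : \sum_(i < N) \int[mu i]_x f^\+ x \is a fin_num.
  by apply/sum_fin_numP => i _ _; exact: pfin.
rewrite -muleBr ?fin_num_adde_defr//; congr (_ * _).
under [RHS]eq_bigr do rewrite integralE.
rewrite [RHS]big_split /= sumeN//.
by move=> i j _ _; rewrite ge0_adde_def// !inE integral_ge0.
Qed.

End averaged_measures.

(** * Integration of a function bounded by an average of functions *)

Section integral_of_average.
Local Open Scope ereal_scope.
Context {d : measure_display} {U : measurableType d} {R : realType}.
Variable mu : {measure set U -> \bar R}.

Let pos (h : U -> R) x : R := Num.max (h x) 0%R.
Let neg (h : U -> R) x : R := Num.max (- h x)%R 0%R.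

Let posE h : (EFin \o h)^\+ = EFin \o pos h.
Proof. by apply/funext => x; rewrite funeposE /= -EFin_max. Qed.

Let negE h : (EFin \o h)^\- = EFin \o neg h.
Proof. by apply/funext => x; rewrite funenegE /= -EFin_max. Qed.

Let posBneg h x : h x = (pos h x - neg h x)%R.
Proof.
rewrite /pos /neg; have [h0|h0] := leP (h x) 0%R.
  by rewrite max_l ?oppr_ge0// sub0r opprK.
by rewrite max_r ?oppr_le0 ?ltW// subr0.
Qed.

Let pos_ge0 h x : (0 <= pos h x)%R.
Proof. by rewrite le_max lexx orbT. Qed.

Let neg_ge0 h x : (0 <= neg h x)%R.
Proof. by rewrite le_max lexx orbT. Qed.

(* The negative parts may have infinite integrals, so the inequality is first
   rearranged into one between integrals of nonnegative functions. *)
Lemma integral_le_avg (k : R) N (g : U -> R) (f : 'I_N -> U -> R) :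
  (0 <= k)%R -> measurable_fun setT g ->
  (forall i, measurable_fun setT (f i)) ->
  (forall x, g x <= k * \sum_i f i x)%R ->
  (forall i, \int[mu]_x (EFin \o f i)^\+ x < +oo) ->
  \int[mu]_x (g x)%:E <= k%:E * \sum_i \int[mu]_x (f i x)%:E.
Proof.
move=> k0 mg mf gf foo.
have mpos h : measurable_fun setT h -> measurable_fun setT (EFin \o pos h).
  by move=> mh; rewrite -posE; apply/measurable_funepos/measurable_EFinP.
have mneg h : measurable_fun setT h -> measurable_fun setT (EFin \o neg h).
  by move=> mh; rewrite -negE; apply/measurable_funeneg/measurable_EFinP.
pose p i := \int[mu]_x (pos (f i) x)%:E; pose n i := \int[mu]_x (neg (f i) x)%:E.
pose a := \int[mu]_x (pos g x)%:E; pose b := \int[mu]_x (neg g x)%:E.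
have n0 i : 0 <= n i by apply: integral_ge0 => x _; rewrite lee_fin.
have pfin i : p i \is a fin_num.
  rewrite ge0_fin_numE; last by apply: integral_ge0 => x _; rewrite lee_fin.
  by have := foo i; rewrite posE.
have sfin : \sum_i p i \is a fin_num by apply/sum_fin_numP => i _ _.
have b0 : 0 <= b by apply: integral_ge0 => x _; rewrite lee_fin.
have -> : \int[mu]_x (g x)%:E = a - b by rewrite integralE posE negE.
have -> : k%:E * \sum_i \int[mu]_x (f i x)%:E =
    k%:E * \sum_i p i - k%:E * \sum_i n i.
  rewrite -muleBr ?fin_num_adde_defr//; congr (_ * _).
  transitivity (\sum_i (p i - n i)).
    by apply: eq_bigr => i _; rewrite integralE posE negE.
  rewrite [LHS]big_split /= sumeN//.
  by move=> i j _ _; rewrite ge0_adde_def// !inE.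
have intE (h : 'I_N -> U -> R) : (forall i x, 0 <= h i x)%R ->
    (forall i, measurable_fun setT (EFin \o h i)) ->
    \int[mu]_x (k * \sum_i h i x)%:E = k%:E * \sum_i \int[mu]_x (h i x)%:E.
  move=> h0 mh; under eq_integral do rewrite EFinM -sumEFin.
  rewrite ge0_integralZl_EFin//; last 2 first.
  - by move=> x _; rewrite sume_ge0// => i _; rewrite lee_fin.
  - by apply: emeasurable_sum => i; exact: mh.
  by rewrite ge0_integral_sum// => i x _; rewrite lee_fin.
have sump_ge0 (c : 'I_N -> R) : (forall i, 0 <= c i)%R ->
    (0 <= k * \sum_i c i)%R by move=> c0; rewrite mulr_ge0// sumr_ge0.
have msum (h : 'I_N -> U -> R) : (forall i, measurable_fun setT (EFin \o h i)) ->
    measurable_fun setT (fun x => (k * \sum_i h i x)%:E).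
  move=> mh; under eq_fun do rewrite EFinM -sumEFin.
  by apply: measurable_funeM; apply: emeasurable_sum => i; exact: mh.
have sumf x : (\sum_i f i x = \sum_i pos (f i) x - \sum_i neg (f i) x)%R.
  by rewrite -sumrB; apply: eq_bigr => i _; exact: posBneg.
have le1 : a <= k%:E * \sum_i p i.
  rewrite -intE//; last by move=> i; exact: mpos.
  apply: ge0_le_integral_subset => // x _; rewrite lee_fin//; first exact: sump_ge0.
  rewrite ge_max sump_ge0// andbT; apply: (le_trans (gf x)).
  rewrite ler_wpM2l// ler_sum// => i _.
  by rewrite le_max lexx.
have le2 : a + k%:E * \sum_i n i <= b + k%:E * \sum_i p i.
  rewrite -!intE//; [|by move=> i; exact: mpos|by move=> i; exact: mneg].
  rewrite -ge0_integralD//; last 4 first.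
  - by move=> x _; rewrite lee_fin.
  - exact: mpos.
  - by move=> x _; rewrite lee_fin sump_ge0.
  - by apply: msum => i; exact: mneg.
  rewrite -ge0_integralD//; last 4 first.
  - by move=> x _; rewrite lee_fin.
  - exact: mneg.
  - by move=> x _; rewrite lee_fin sump_ge0.
  - by apply: msum => i; exact: mpos.
  apply: ge0_le_integral_subset => // x _; rewrite -?EFinD ?lee_fin.
  - by rewrite addr_ge0// sump_ge0.
  - by rewrite addr_ge0// sump_ge0.
  - by have := gf x; rewrite sumf (posBneg g); lra.
have kpfin : k%:E * \sum_i p i \is a fin_num by rewrite fin_numM.
have kn0 : 0 <= k%:E * \sum_i n i by rewrite mule_ge0 ?lee_fin ?sume_ge0.
have a0 : 0 <= a by apply: integral_ge0 => x _; rewrite lee_fin.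
(* By [le1], [a] is finite. By [le2], an infinite sum of negative parts on the right forces [b] to
   be infinite, and then the left-hand side is [-oo]. *)
move: (k%:E * _) (k%:E * _) a b a0 b0 kn0 kpfin le1 le2.
move=> [P||] [M||] [a||] [b||]//; rewrite ?leey ?leNye// -?EFinD !lee_fin; lra.
Qed.

End integral_of_average.

(** * Borel sets and measures concentrated on a set *)

Section borel.
Context {R : realType} {m : nat}.

Lemma open_borel (A : set 'rV[R]_m) :
  open A -> measurable (A : set (borelRV R m)).
Proof. exact: sub_sigma_algebra. Qed.

Lemma closed_borel (A : set 'rV[R]_m) :
  closed A -> measurable (A : set (borelRV R m)).
Proof.
move=> cA; rewrite -(setCK A); apply: measurableC; apply: open_borel.
exact: closed_openC.
Qed.

Lemma measurable_open_gt (f : borelRV R m -> R) :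
  (forall a, open [set z : 'rV[R]_m | a < f z]) -> measurable_fun setT f.
Proof.
move=> of_; apply: (measurability _ (RGenOInfty.measurableE R)).
move=> /= _ [_ [a ->]] <-; apply: measurableI => //.
by apply: open_borel; rewrite preimage_itvoy; exact: of_.
Qed.

Lemma prob_onC (Z : set 'rV[R]_m) (P : borel_measure R m) :
  measurable (Z : set (borelRV R m)) -> prob_on Z P -> P (~` Z) = 0%E.
Proof.
move=> mZ [PT PZ]; have PE : (1 = P (~` Z) + 1)%E.
  rewrite -{1}PT -PZ (_ : [set: borelRV R m] = ~` Z `|` Z); last by rewrite setUC setUv.
  exact: (measureU P (measurableC mZ) mZ (setICl Z)).
by rewrite -[LHS](@addeK _ 1%E)// -PE subee.
Qed.

End borel.

(** * Convexity, measurability and growth of the loss *)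

Section loss.
Context {R : realType} {n m K : nat}.
Context {X : set 'rV[R]_n} {Z : set 'rV[R]_m}.
Context {c : 'rV[R]_m -> 'rV[R]_m -> R} {PP : set (borel_measure R m)}.
Context {ell_ : 'I_K -> 'rV[R]_n -> 'rV[R]_m -> R}.
Context {ell : 'rV[R]_n -> 'rV[R]_m -> R}.
Hypothesis reg : regularity X Z c PP ell_ ell.

Lemma loss_ge k x z : ell_ k x z <= ell x z.
Proof. by rewrite -lee_fin (reg_max reg); exact: le_bigmax. Qed.

(** The maximum starts from the default [-oo], which lies below every real value, so some index
    attains it. *)
Lemma loss_attained x z : exists k, ell x z = ell_ k x z.
Proof.
have : ((ell x z)%:E <= \big[Order.max/-oo]_(k < K) (ell_ k x z)%:E)%E.
  by rewrite -(reg_max reg).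
case/bigmax_geP => // -[k _]; rewrite lee_fin => le_k.
by exists k; apply/eqP; rewrite eq_le le_k loss_ge.
Qed.

(** The piece active at the combination is convex and lies below [ell] at both endpoints. *)
Lemma loss_convex z : convex_function [set: 'rV[R]_n] (ell ^~ z).
Proof.
move=> t u v uT vT; have [k ->] := loss_attained (conv t u v) z.
apply: (le_trans (reg_convex reg k z t uT vT)).
by rewrite lerD// ler_wpM2l ?loss_ge// subr_ge0.
Qed.

(** A strict superlevel set of the loss is the union of those of its concave pieces, which are
    open. *)
Lemma loss_measurable x : measurable_fun setT (ell x : borelRV R m -> R).
Proof.
apply: measurable_open_gt => a.
have -> : [set z | a < ell x z] = \bigcup_k [set z | a < ell_ k x z].
  apply/seteqP; split => z /=.
    by have [k ->] := loss_attained x z; exists k.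
  by move=> [k _ /= ak]; apply: lt_le_trans ak (loss_ge _ _ _).
apply: bigcup_open => k _.
have := @open_convex_lt _ _ _ (- a) (reg_concave reg k x).
by congr open; apply/funext => z /=; rewrite ltrN2.
Qed.

Lemma loss_growth N (zhat : nat -> 'rV[R]_m) x :
  (forall i, (i < N)%N -> Z (zhat i)) ->
  exists2 C : R, 0 <= C & exists2 D : R, 0 < D &
    forall z i, Z z -> (i < N)%N -> ell x z <= C + D * c z (zhat i).
Proof.
move=> Zzhat; have [nrm [p [nrmP p1 nrmc _]]] := reg_growth reg.
have [kap kap0 kapP] := is_norm_dominates nrmP.
have /choice[B HB] k : exists B, 0 <= B /\
    forall z, ell_ k x z <= ell_ k x 0 + B * `|z|.
  have [B B0 HB] := convex_lower_lipschitz 0 (reg_concave reg k x).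
  by exists B; split=> // z; have := HB z; rewrite add0r; lra.
(* Sums over pieces and over atoms make the constants uniform in [k] and [i]. *)
pose C0 := \sum_k `|ell_ k x 0|; pose B0 := \sum_k B k.
pose H := \sum_(i < N) `|zhat i|.
have C0_ge0 : 0 <= C0 by exact: sumr_ge0.
have B0_ge0 : 0 <= B0 by apply: sumr_ge0 => k _; case: (HB k).
have H_ge0 : 0 <= H by exact: sumr_ge0.
exists (C0 + B0 * (kap + H)); first by rewrite addr_ge0// mulr_ge0// addr_ge0.
(* The summand 1 makes the slope strictly positive, so that one can later divide by it. *)
exists (B0 * kap + 1); first by rewrite ltr_wpDl// mulr_ge0.
move=> z i Zz iN; have Zi := Zzhat i iN.
(* A number is either at most 1 or, since [1 <= p], at most its [p]-th power. *)
have nc : nrm (z - zhat i) <= 1 + c z (zhat i).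
  apply: (@le_trans _ _ (1 + nrm (z - zhat i) `^ p)); last by rewrite lerD2l nrmc.
  have [le1|/ltW ge1] := leP (nrm (z - zhat i)) 1.
    by apply: (le_trans le1); rewrite lerDl powR_ge0.
  by apply: (le_trans (le1r_powR ge1 p1)); rewrite lerDr.
have c0 : 0 <= c z (zhat i) by apply: le_trans (nrmc _ _ Zz Zi); exact: powR_ge0.
have zH : `|z| <= kap * (1 + c z (zhat i)) + H.
  rewrite -[z in leLHS](subrK (zhat i)); apply: (le_trans (ler_normD _ _)).
  apply: lerD; first by apply: (le_trans (kapP _)); rewrite ler_wpM2l.
  by rewrite /H (bigD1 (Ordinal iN))//= lerDl sumr_ge0.
have [k ->] := loss_attained x z; have [Bk0 le_k] := HB k.
apply: (le_trans (le_k z)).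
have : ell_ k x 0 <= C0.
  apply: (le_trans (ler_norm _)).
  by rewrite /C0 (bigD1 k)//= lerDl sumr_ge0.
have : B k * `|z| <= B0 * (kap * (1 + c z (zhat i)) + H).
  apply: ler_pM => //; rewrite /B0 (bigD1 k)//= lerDl sumr_ge0// => j _.
  by case: (HB j).
by lra.
Qed.

End loss.

(** * Convexity of the ambiguity set and membership of the empirical measure *)

Section ambiguity.
Local Open Scope ereal_scope.
Context {R : realType} {m : nat}.

Lemma avg_const T (a : \bar R) (F : nat -> \bar R) : (0 < T)%N ->
  (forall t, (t < T)%N -> F t = a) ->
  (T%:R^-1)%:E * \sum_(t < T) F t = a.
Proof.
move=> T0 Fa; rewrite (eq_bigr (fun=> a)); last by move=> t _; exact: Fa.
rewrite sumr_const card_ord (_ : (a *+ T)%R = T%:R%:E * a) ?mule_natl//.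
by rewrite -mule_natl muleA -EFinM mulVf ?mul1e// pnatr_eq0 -lt0n//.
Qed.

Lemma prob_on_avg (Z : set 'rV[R]_m) T (Q : nat -> borel_measure R m) :
  (0 < T)%N -> (forall t, (t < T)%N -> prob_on Z (Q t)) ->
  prob_on Z (avg_measure T Q).
Proof.
move=> T0 QZ; split.
- by apply: (@avg_const T 1 (fun t => Q t setT)) => // t /QZ[].
- by apply: (@avg_const T 1 (fun t => Q t Z)) => // t /QZ[].
Qed.

(** Marginals are averaged along with the plans, so a common second marginal is preserved. *)
Definition avg_plan T
    (gam : nat -> {measure set (borelRV R m * borelRV R m) -> \bar R}) :
    {measure set (borelRV R m * borelRV R m) -> \bar R} :=
  mscale (T%:R^-1)%:nng%R (msum gam T).

Context (Z : set 'rV[R]_m) (c : 'rV[R]_m -> 'rV[R]_m -> R).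
Hypothesis cost : transport_cost Z c.

Let cost_pos (w : borelRV R m * borelRV R m) :
  (Z `*` Z) w -> 0 <= (c w.1 w.2)%:E.
Proof. by move=> [? ?]; rewrite lee_fin; exact: (cost_ge0 cost). Qed.

(** Since [OT] is an infimum, plans of cost at most [r + e] are averaged, for arbitrary [e > 0]. *)
Lemma OT_avg (P : borel_measure R m) T (Q : nat -> borel_measure R m) (r : R) :
  (0 < T)%N -> (forall t, (t < T)%N -> OT Z c (Q t) P <= r%:E) ->
  OT Z c (avg_measure T Q) P <= r%:E.
Proof.
move=> T0 QP; apply/lee_addgt0Pr => e e0.
have /choice[gam gamP] t : exists gam, (t < T)%N -> coupling (Q t) P gam /\
    \int[gam]_(w in Z `*` Z) (c w.1 w.2)%:E <= (r + e)%:E.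
  (* The choice ranges over all [t]; the zero measure is a default beyond [T]. *)
  have [tT|Tt] := ltnP t T; last by exists mzero.
  have : OT Z c (Q t) P < (r + e)%:E.
    by apply: le_lt_trans (QP t tT) _; rewrite lte_fin ltrDl.
  by case/ereal_inf_lt => _ [gam ? <-] /ltW; exists gam.
pose avg := avg_plan T gam.
have OTavg : OT Z c (avg_measure T Q) P <=
    \int[avg]_(w in Z `*` Z) (c w.1 w.2)%:E.
  apply: ereal_inf_lbound; exists avg => //; split=> A mA.
    rewrite /avg /= /avg_measure /mscale/= /mscale /msum/=; congr (_ * _).
    by apply: eq_bigr => t _; case: (gamP t (ltn_ord t)) => -[->].
  apply: (@avg_const T (P A) (fun t => gam t (setT `*` A))) => // t tT.
  by case: (gamP t tT) => -[_ ->].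
apply: (le_trans OTavg); apply: (le_trans (ge0_integral_avg_le _ _ _ cost_pos)).
rewrite -[leRHS](@avg_const T _ (fun=> (r + e)%:E))//.
rewrite lee_wpmul2l ?lee_fin ?invr_ge0//; apply: lee_sum => t _.
by case: (gamP t (ltn_ord t)).
Qed.

Context (N : nat) (zhat : nat -> 'rV[R]_m).
Hypotheses (N0 : (0 < N)%N) (Zzhat : forall i, (i < N)%N -> Z (zhat i)).

Lemma prob_on_empirical : prob_on Z (empirical N zhat).
Proof.
apply: prob_on_avg => // i /Zzhat Zi; split => /=; rewrite diracE.
  by rewrite in_setT.
by rewrite mem_set.
Qed.

(** The plan carried by the diagonal pairs of atoms has cost 0. *)
Lemma OT_empirical (r : R) : (0 <= r)%R ->
  OT Z c (empirical N zhat) (empirical N zhat) <= r%:E.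
Proof.
move=> r0; pose D i : {measure set (borelRV R m * borelRV R m) -> \bar R} :=
  dirac (zhat i : borelRV R m, zhat i : borelRV R m).
pose avg := avg_plan N D.
have OTavg : OT Z c (empirical N zhat) (empirical N zhat) <=
    \int[avg]_(w in Z `*` Z) (c w.1 w.2)%:E.
  apply: ereal_inf_lbound; exists avg => //; split=> A mA.
    congr (_ * _); apply: eq_bigr => i _.
    by rewrite /D /= !diracE in_setX in_setT andbT.
  congr (_ * _); apply: eq_bigr => i _.
  by rewrite /D /= !diracE in_setX in_setT.
apply: (le_trans OTavg); apply: (le_trans (ge0_integral_avg_le _ _ _ cost_pos)).
rewrite -[leRHS](@avg_const N _ (fun=> r%:E))//.
rewrite lee_wpmul2l ?lee_fin ?invr_ge0//; apply: lee_sum => i _.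
have Zi := Zzhat (ltn_ord i).
apply: (le_trans (ge0_integral_dirac_le _ cost_pos)) => //=.
by rewrite (cost_diag cost)// lee_fin.
Qed.

End ambiguity.

(** * Integrability of positive parts over the ambiguity set *)

Section finite_positive_part.
Local Open Scope ereal_scope.
Context {R : realType} {m : nat}.
Context (Z : set 'rV[R]_m) (c : 'rV[R]_m -> 'rV[R]_m -> R).
Context (N : nat) (zhat : nat -> 'rV[R]_m).
Hypothesis cost : transport_cost Z c.
Hypothesis Zzhat : forall i, (i < N)%N -> Z (zhat i).
Hypothesis mZ : measurable (Z : set (borelRV R m)).

Let F : set (borelRV R m) := \bigcup_(i in `I_N) [set zhat i].

Let mF : measurable F.
Proof.
apply: fin_bigcup_measurable => // i _; apply: closed_borel.
exact/accessible_closed_set1/hausdorff_accessible/norm_hausdorff.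
Qed.

Let empiricalCF : empirical N zhat (~` F) = 0.
Proof.
rewrite /empirical /avg_measure /mscale /= /mscale /= /msum big1 ?mule0// => i _.
rewrite /= diracE memNset//; apply.
by exists (val i) => //=; exact: ltn_ord.
Qed.

(** Change of variables: [P] agrees with the image of [gam] under the first projection. *)
Lemma integral_fst_coupling (P Q : borel_measure R m)
    (gam : {measure set (borelRV R m * borelRV R m) -> \bar R})
    (h : borelRV R m -> \bar R) : coupling P Q gam ->
  measurable_fun setT h -> (forall z, 0 <= h z) ->
  \int[P]_z h z = \int[gam]_w h w.1.
Proof.
move=> [gamP _] mh h0.
have := ge0_integral_pushforward (@measurable_fst _ _ (borelRV R m) (borelRV R m))
  gam measurableT mh (fun z _ => h0 z).
rewrite preimage_setT => <-.
pose phi : {mfun (borelRV R m * borelRV R m)%type >-> borelRV R m} :=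
  HB.pack (@fst (borelRV R m) (borelRV R m))
    (isMeasurableFun.Build _ _ _ _ _ (@measurable_fst _ _ (borelRV R m) (borelRV R m))).
apply: (@eq_measure_integral _ _ _ _ (pushforward gam phi)) => A mA _.
rewrite -gamP//=; congr (gam _).
by apply/seteqP; split => [w []|w].
Qed.

(* Up to null sets the plan lives on [Z `*` F], where the cost dominates
   [(g - C) / D]. *)
Lemma integral_funepos_lty (Q : borel_measure R m) (g : borelRV R m -> R)
    (C D : R) :
  prob_on Z Q -> OT Z c Q (empirical N zhat) < +oo ->
  measurable_fun setT g -> (0 <= C)%R -> (0 < D)%R ->
  (forall z i, Z z -> (i < N)%N -> g z <= C + D * c z (zhat i))%R ->
  \int[Q]_z (EFin \o g)^\+ z < +oo.
Proof.
move=> QZ /ereal_inf_lt[_ [gam gamQ <-] gam_lty] mg C0 D0 gc.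
pose h z : R := Num.max ((g z - C) / D)%R 0%R.
have h0 z : (0 <= h z)%R by rewrite le_max lexx orbT.
have mh : measurable_fun setT (EFin \o h).
  apply/measurable_EFinP/measurable_maxr => //.
  by apply: measurable_funM => //; exact: measurable_funB.
have gh z : (g z <= C + D * h z)%R.
  have : (D * ((g z - C) / D) <= D * h z)%R.
    by rewrite ler_wpM2l ?(ltW D0)// le_max lexx.
  by rewrite mulrC divfK ?gt_eqF//; lra.
have h_lty : \int[Q]_z (h z)%:E < +oo.
  rewrite (integral_fst_coupling gamQ)//.
  pose W : set (borelRV R m * borelRV R m) := (~` Z `*` setT) `|` (setT `*` ~` F).
  have mZT : measurable (~` (Z : set (borelRV R m)) `*` [set: borelRV R m]).
    by apply: measurableX => //; exact: measurableC.
  have mTF : measurable ([set: borelRV R m] `*` ~` F).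
    by apply: measurableX => //; exact: measurableC.
  have W0 : gam W = 0.
    rewrite measureU0//.
      by rewrite gamQ.1 ?(prob_onC mZ QZ)//; exact: measurableC.
    by rewrite gamQ.2 ?empiricalCF//; exact: measurableC.
  rewrite (@ge0_negligible_integral _ _ _ _ _ W)//; last 3 first.
  - exact: measurableU.
  - exact: (measurableT_comp mh (@measurable_fst _ _ (borelRV R m) (borelRV R m))).
  - by move=> w _; rewrite lee_fin.
  apply: le_lt_trans gam_lty.
  have WZ w : (setT `\` W) w -> Z w.1 /\ F w.2.
    move=> [_] /not_orP[w1 w2]; split; apply: contrapT => ?; [apply: w1|apply: w2];
    by split.
  apply: ge0_le_integral_subset.
  - by move=> w /WZ[? [i iN /= ->]]; split=> //=; exact: Zzhat.
  - by move=> w _; rewrite lee_fin.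
  - by move=> w [? ?]; rewrite lee_fin; exact: (cost_ge0 cost).
  - move=> w /WZ[Zw [i iN /= ->]]; have Zi := Zzhat iN.
    rewrite lee_fin ge_max (cost_ge0 cost)// andbT ler_pdivrMr// mulrC.
    by have := gc _ _ Zw iN; lra.
(* The positive part of [g] is at most [C + D * h], and [Q] has mass 1, so the constant contributes
   [C]. *)
apply: (@le_lt_trans _ _ (\int[Q]_z (C%:E + D%:E * (h z)%:E))).
  apply: ge0_le_integral_subset => // z _.
    by rewrite -EFinM -EFinD lee_fin addr_ge0// mulr_ge0// ltW.
  rewrite funeposE /= -EFin_max -EFinM -EFinD lee_fin ge_max gh/=.
  by rewrite addr_ge0// mulr_ge0// ltW.
rewrite ge0_integralD//; last 2 first.
- by move=> z _; rewrite -EFinM lee_fin mulr_ge0// ltW.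
- exact: measurable_funeM.
rewrite integral_cst// QZ.1 mule1 ge0_integralZl_EFin ?ltW//; last first.
  by move=> z _; rewrite lee_fin.
by rewrite lte_add_pinfty ?ltry// lte_mul_pinfty ?lee_fin ?ltW.
Qed.

End finite_positive_part.

(** * Finiteness of expected losses *)

Section expected_loss.
Local Open Scope ereal_scope.
Context {R : realType} {n m : nat}.

(** The value is real, so the empirical measure can bound the oracle's answer away from [-oo]. *)
Lemma expected_loss_empirical N (zhat : nat -> 'rV[R]_m)
    (ell : 'rV[R]_n -> 'rV[R]_m -> R) y :
  measurable_fun setT (ell y : borelRV R m -> R) ->
  expected_loss ell y (empirical N zhat) =
  (N%:R^-1 * \sum_(i < N) ell y (zhat i))%:E.
Proof.
move=> mell; have mE : measurable_fun setT (EFin \o (ell y : borelRV R m -> R)).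
  exact/measurable_EFinP.
rewrite /expected_loss /empirical /avg_measure integral_avg//; last first.
  move=> i _; rewrite integral_dirac//; last exact: measurable_funepos.
  by rewrite diracT mul1e funeposE /= -EFin_max ltry.
rewrite EFinM -sumEFin; congr (_ * _); apply: eq_bigr => i _.
by rewrite integral_dirac// diracT mul1e.
Qed.

Lemma expected_loss_lty (ell : 'rV[R]_n -> 'rV[R]_m -> R) y
    (Q : borel_measure R m) :
  \int[Q]_z (EFin \o ell y)^\+ z < +oo -> expected_loss ell y Q < +oo.
Proof.
move=> pos; rewrite /expected_loss integralE; apply: le_lt_trans pos.
by rewrite geeDl// oppe_le0 integral_ge0.
Qed.

End expected_loss.

(** * The gap bound *)

Theorem theorem4 (R : realType) (n m : nat)
    (X : set 'rV[R]_n) (Z : set 'rV[R]_m)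
    (c : 'rV[R]_m -> 'rV[R]_m -> R)
    (N : nat) (zhat : nat -> 'rV[R]_m) (rho : R)
    (K : nat) (ell_ : 'I_K -> 'rV[R]_n -> 'rV[R]_m -> R)
    (ell : 'rV[R]_n -> 'rV[R]_m -> R)
    (T : nat) (delta : R)
    (A : 'rV[R]_n -> ('rV[R]_n -> \bar R) -> 'rV[R]_n)
    (x : nat -> 'rV[R]_n) (Q : nat -> borel_measure R m)
    (Reg : nat -> R) :
  let PP := ambiguity_set Z c N zhat rho in
  transport_cost Z c ->
  (0 < N)%N ->
  (forall i, (i < N)%N -> Z (zhat i)) ->
  0 < rho ->
  regularity X Z c PP ell_ ell ->
  (0 < T)%N ->
  0 <= delta ->
  DBR_run X PP ell delta A T x Q ->
  Reg =o_\oo (fun t : nat => t%:R : R) ->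
  (regret X ell T x Q <= (Reg T)%:E)%E ->
  [/\ X (avg_point T x), PP (avg_measure T Q) &
      (gap X PP ell (avg_point T x) (avg_measure T Q)
         <= (Reg T / T%:R + delta)%:E)%E].
Proof.
move=> PP cost N0 Zzhat rho0 reg T0 _ run _ reg_le.
have mZ := closed_borel (reg_Zclosed reg).
have Xx t : (t < T)%N -> X (x t).
  case: t => [_|t tT]; first exact: run_init run.
  by case: (run_update run (ltnW tT)).
have PPQ t : (t < T)%N -> PP (Q t) by case/(run_oracle run).
have PPavg : PP (avg_measure T Q).
  split; first by apply: prob_on_avg => // t /PPQ[].
  by apply: OT_avg => // t /PPQ[].
have PPhat : PP (empirical N zhat).
  by split; [exact: prob_on_empirical|apply: OT_empirical => //; exact: ltW].
have pos_lty y Q' : PP Q' -> (\int[Q']_z (EFin \o ell y)^\+ z < +oo)%E.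
  move=> [Q'Z Q'rho]; have [C C0 [D D0 ellD]] := loss_growth reg y Zzhat.
  apply: (integral_funepos_lty cost Zzhat mZ Q'Z _ _ C0 D0) => //.
    by apply: le_lt_trans Q'rho _; rewrite ltry.
  exact: loss_measurable reg y.
have worst_le t Q' : (t < T)%N -> PP Q' -> (expected_loss ell (x t) Q' <=
    expected_loss ell (x t) (Q t) + delta%:E)%E.
  move=> tT PPQ'; have [_] := run_oracle run tT.
  rewrite leeBlDr//; apply: le_trans.
  by apply: ereal_sup_ubound; exists Q'.
have loss_fin t : (t < T)%N -> expected_loss ell (x t) (Q t) \is a fin_num.
  move=> tT; rewrite fin_numElt expected_loss_lty ?andbT; last exact/pos_lty/PPQ.
  have := worst_le t _ tT PPhat; rewrite expected_loss_empirical.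
    by case: (expected_loss _ _ _) => [r|//|]; rewrite ?ltNyr// addNye leeNy_eq.
  exact: loss_measurable reg (x t).
have [s sE] : exists s, (\sum_(t < T) expected_loss ell (x t) (Q t))%E = s%:E.
  suff /fineK <- : (\sum_(t < T) expected_loss ell (x t) (Q t))%E \is a fin_num.
    by eexists.
  by apply/sum_fin_numP => t _ _; exact: loss_fin.
pose I := ereal_inf [set (\sum_(t < T) expected_loss ell y (Q t))%E | y in X].
(* The value at [x 0] bounds [I] from above. As [s] is real, [I = -oo] would make the regret [+oo],
   against its real bound. *)
have [i iE] : exists i, I = i%:E.
  have : (I < +oo)%E.
    apply: (@le_lt_trans _ _ (\sum_(t < T) expected_loss ell (x 0%N) (Q t))%E).
      by apply: ereal_inf_lbound; exists (x 0%N) => //; exact: Xx.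
    by apply: lte_sum_pinfty => t _; apply/expected_loss_lty/pos_lty/PPQ.
  move: reg_le; rewrite /regret sE -/I.
  by case: I => [i _ _|//|//]; exists i.
have reg_si : s - i <= Reg T.
  by move: reg_le; rewrite /regret sE -/I iE -EFinB lee_fin.
split => //.
  exact: (@convex_set_avg _ _ X T (fun t : 'I_T => x t) (reg_Xconvex reg) T0
    (fun t => Xx t (ltn_ord t))).
have T_gt0 : 0 < T%:R^-1 :> R by rewrite invr_gt0 ltr0n.
have worst_avg : (worst_case PP ell (avg_point T x) <=
    (T%:R^-1 * s + delta)%:E)%E.
  apply: ge_ereal_sup => _ [Q' PPQ' <-].
  have le_avg : (expected_loss ell (avg_point T x) Q' <=
      (T%:R^-1)%:E * \sum_(t < T) expected_loss ell (x t) Q')%E.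
    apply: integral_le_avg => //.
    - exact: loss_measurable reg _.
    - by move=> t; exact: loss_measurable reg _.
    - by move=> z; exact: convex_function_avg (loss_convex reg z) T0.
    - by move=> t; exact: pos_lty.
  apply: (le_trans le_avg).
  (* Spreading [delta] over the [T] terms lets the oracle inequality be summed term by term. *)
  have -> : T%:R^-1 * s + delta = T%:R^-1 * (s + T%:R * delta).
    by rewrite mulrDr mulrA mulVf ?mul1r// pnatr_eq0 -lt0n.
  rewrite EFinM lee_pmul2l// EFinD -sE.
  have -> : (T%:R * delta)%:E = (\sum_(t < T) delta%:E)%E.
    by rewrite sumEFin sumr_const card_ord mulr_natl.
  rewrite -big_split /=; apply: lee_sum => t _.
  exact: worst_le.
have inf_avg : ((T%:R^-1 * i)%:E <=
    ereal_inf [set expected_loss ell y (avg_measure T Q) | y in X])%E.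
  apply: le_ereal_inf_tmp => _ [y Xy <-].
  rewrite /expected_loss /avg_measure integral_avg; last 2 first.
  - by apply/measurable_EFinP; exact: loss_measurable reg y.
  - by move=> t tT; exact/pos_lty/PPQ.
  rewrite EFinM lee_pmul2l//= -iE.
  by apply: ereal_inf_lbound; exists y.
apply: (le_trans (leeB worst_avg inf_avg)).
rewrite -EFinB lee_fin; have := reg_si; rewrite -(ler_pM2l T_gt0).
by rewrite [Reg T / _]mulrC; lra.
Qed.
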